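(* Let $\Gamma$ be an arbitrary set and let $X$ be a closed linear subspace of $c_0(\Gamma)$. Then the dual space $X^*$ has the $1$-Schur property, i.e. for every bounded sequence $(x_k^* )$ in $X^*$ one has $\operatorname{ca}(x_k^* )\le \delta(x_k^* )$.
   Context: For a bounded sequence $(x_k)$ in a Banach space $Z$ define $\operatorname{ca}(x_k)=\inf_{n\in\mathbb N}\operatorname{diam}\{x_k:k\ge n\}$ (diameter in norm) and $\delta(x_k)=\sup_{z^*\in B_{Z^*}}\inf_{n\in\mathbb N}\operatorname{diam}\{z^*(x_k):k\ge n\}$. A Banach space $Z$ has the $C$-Schur property ($C\ge0$) if $\operatorname{ca}(x_k)\le C\,\delta(x_k)$ for every bounded sequence $(x_k)$ in $Z$. Here these quantities are applied with $Z=X^*$, so the supremum in $\delta$ runs over the unit ball of $X^{**}$. *)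

(* Defs.v *)
From Stdlib Require Import Reals Lra List ClassicalEpsilon.
Open Scope R_scope.

(* Supremum of a set of reals: the least upper bound if the set is
   nonempty and bounded above, 0 otherwise (only used on such sets). *)
Definition Rsup (E : R -> Prop) : R :=
  match excluded_middle_informative (bound E) with
  | left hb =>
      match excluded_middle_informative (exists x, E x) with
      | left hne => proj1_sig (completeness E hb hne)
      | right _ => 0
      end
  | right _ => 0
  end.

Definition Rinf (E : R -> Prop) : R := - Rsup (fun y => E (- y)).

Definition c0 {G : Type} (f : G -> R) : Prop :=
  forall eps, 0 < eps -> exists l : list G, forall g, eps <= Rabs (f g) -> In g l.

Definition supnorm {G : Type} (f : G -> R) : R :=
  Rsup (fun r => exists g, r = Rabs (f g)).

Definition fadd {G : Type} (f h : G -> R) : G -> R := fun g => f g + h g.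
Definition fscal {G : Type} (a : R) (f : G -> R) : G -> R := fun g => a * f g.

Definition closed_subspace_c0 {G : Type} (X : (G -> R) -> Prop) : Prop :=
  (forall f, X f -> c0 f) /\
  X (fun _ => 0) /\
  (forall f h, X f -> X h -> X (fadd f h)) /\
  (forall a f, X f -> X (fscal a f)) /\
  (forall (u : nat -> G -> R) (f : G -> R),
      (forall n, X (u n)) -> c0 f ->
      Un_cv (fun n => supnorm (fun g => u n g - f g)) 0 -> X f).

(* Elements of the dual X^* : bounded linear functionals on X
   (represented by functions on G -> R, only their values on X matter). *)
Definition in_dual {G : Type} (X : (G -> R) -> Prop) (phi : (G -> R) -> R) : Prop :=
  (forall f h, X f -> X h -> phi (fadd f h) = phi f + phi h) /\
  (forall a f, X f -> phi (fscal a f) = a * phi f) /\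
  (exists M, forall f, X f -> Rabs (phi f) <= M * supnorm f).

Definition dnorm {G : Type} (X : (G -> R) -> Prop) (phi : (G -> R) -> R) : R :=
  Rsup (fun r => exists f, X f /\ supnorm f <= 1 /\ r = Rabs (phi f)).

Definition dsub {G : Type} (phi psi : (G -> R) -> R) : (G -> R) -> R :=
  fun f => phi f - psi f.
Definition dadd {G : Type} (phi psi : (G -> R) -> R) : (G -> R) -> R :=
  fun f => phi f + psi f.
Definition dscal {G : Type} (a : R) (phi : (G -> R) -> R) : (G -> R) -> R :=
  fun f => a * phi f.

Definition in_bidual {G : Type} (X : (G -> R) -> Prop)
  (Phi : ((G -> R) -> R) -> R) : Prop :=
  (forall phi psi, in_dual X phi -> in_dual X psi ->
     Phi (dadd phi psi) = Phi phi + Phi psi) /\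
  (forall a phi, in_dual X phi -> Phi (dscal a phi) = a * Phi phi) /\
  (exists M, forall phi, in_dual X phi -> Rabs (Phi phi) <= M * dnorm X phi).

Definition bidnorm {G : Type} (X : (G -> R) -> Prop)
  (Phi : ((G -> R) -> R) -> R) : R :=
  Rsup (fun r => exists phi, in_dual X phi /\ dnorm X phi <= 1 /\ r = Rabs (Phi phi)).

Definition ca {G : Type} (X : (G -> R) -> Prop) (x : nat -> (G -> R) -> R) : R :=
  Rinf (fun d => exists n : nat,
    d = Rsup (fun r => exists k l : nat, (n <= k)%nat /\ (n <= l)%nat /\
                          r = dnorm X (dsub (x k) (x l)))).

Definition delta {G : Type} (X : (G -> R) -> Prop) (x : nat -> (G -> R) -> R) : R :=
  Rsup (fun s => exists Phi, in_bidual X Phi /\ bidnorm X Phi <= 1 /\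
    s = Rinf (fun d => exists n : nat,
      d = Rsup (fun r => exists k l : nat, (n <= k)%nat /\ (n <= l)%nat /\
                            r = Rabs (Phi (x k) - Phi (x l))))).

(* Main.v *)
(* If [ca x > t], there are [y n = x (k n) - x (l n)] with [k n, l n >= n] and norm
   above [t], and [f n] in the unit ball of [X] with [y n (f n) > t].  It suffices to
   find a [Phi] of norm at most [1 + eps] with [Phi (y n) >= t - eps] infinitely often.
   Take limits along a free ultrafilter, and let [alpha] be the iterated limit
   (first in [n], then in [m]) of [y n (f m)].  A suitable mean [h] of the [f m] is close
   to the pointwise limit of [f] on any prescribed finite set and satisfies
   [|f n - h| <= 1 + eps] for most [n].  Starting from some [f m], replace [u]
   repeatedly by [u + f n - h], where the finite set is the essential support of [u]:
   the norm stays below [1 + eps], [y n u] and [y n h] both tend to [alpha], so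
   [y n (u + f n - h)] is about [y n (f n) > t], and the values at the earlier
   functionals are almost unchanged.  [Phi] is the weak* limit of these [u]. *)

Require Import Defs.
From Stdlib Require Import Reals Lra Lia List Classical ClassicalEpsilon
  FunctionalExtensionality.
From mathcomp Require filter.
Open Scope R_scope.

(** * Suprema and norms *)

Lemma Rsup_ub (E : R -> Prop) b x : (forall y, E y -> y <= b) -> E x -> x <= Rsup E.
Proof.
  intros hb hx. unfold Rsup.
  destruct (excluded_middle_informative (bound E)) as [h|h];
    [|elim h; exists b; exact hb].
  destruct (excluded_middle_informative (exists x, E x)) as [h'|h'];
    [|elim h'; exists x; exact hx].
  destruct (completeness E h h') as [s [hs hs']]; simpl. exact (hs x hx).
Qed.

Lemma Rsup_le (E : R -> Prop) b : (exists x, E x) -> (forall y, E y -> y <= b) -> Rsup E <= b.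
Proof.
  intros hne hb. unfold Rsup.
  destruct (excluded_middle_informative (bound E)) as [h|h];
    [|elim h; exists b; exact hb].
  destruct (excluded_middle_informative (exists x, E x)) as [h'|h']; [|tauto].
  destruct (completeness E h h') as [s [hs' hs]]; simpl. exact (hs b hb).
Qed.

(** The hypothesis [0 <= b] covers the default value of [Rsup], which is what [supnorm] takes when
    [G] is empty. *)
Lemma Rsup_le_nonneg (E : R -> Prop) b : 0 <= b -> (forall y, E y -> y <= b) -> Rsup E <= b.
Proof.
  intros h0 hb. destruct (classic (exists x, E x)) as [h|h].
  - apply Rsup_le; auto.
  - unfold Rsup.
    destruct (excluded_middle_informative (bound E)); [|exact h0].
    destruct (excluded_middle_informative (exists x, E x)); [tauto|exact h0].
Qed.

Lemma Rsup_nonneg (E : R -> Prop) : (forall y, E y -> 0 <= y) -> 0 <= Rsup E.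
Proof.
  intros h. unfold Rsup.
  destruct (excluded_middle_informative (bound E)); [|lra].
  destruct (excluded_middle_informative (exists x, E x)) as [[x hx]|]; [|lra].
  destruct (completeness E _ _) as [s [hs hs']]; simpl.
  apply Rle_trans with x; [exact (h x hx)|exact (hs x hx)].
Qed.

Lemma Rsup_gt (E : R -> Prop) t : (exists x, E x) -> t < Rsup E -> exists x, E x /\ t < x.
Proof.
  intros hne ht. apply NNPP; intros hn.
  apply (Rlt_not_le _ _ ht), Rsup_le; [exact hne|].
  intros y hy. destruct (Rle_or_lt y t); [assumption|].
  elim hn; exists y; auto.
Qed.

Lemma Rinf_le (E : R -> Prop) b x : (forall y, E y -> b <= y) -> E x -> Rinf E <= x.
Proof.
  intros hb hx. unfold Rinf.
  enough (- x <= Rsup (fun y => E (- y))) by lra.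
  apply Rsup_ub with (- b); [|rewrite Ropp_involutive; exact hx].
  intros y hy. apply hb in hy. lra.
Qed.

Lemma Rinf_ge (E : R -> Prop) b : (exists x, E x) -> (forall y, E y -> b <= y) -> b <= Rinf E.
Proof.
  intros [x hx] hb. unfold Rinf.
  enough (Rsup (fun y => E (- y)) <= - b) by lra.
  apply Rsup_le; [exists (- x); rewrite Ropp_involutive; exact hx|].
  intros y hy. apply hb in hy. lra.
Qed.

Lemma Rabs_le_inv r b : Rabs r <= b -> - b <= r <= b.
Proof.
  intros h. pose proof (Rle_abs r). pose proof (Rle_abs (- r)) as h'.
  rewrite Rabs_Ropp in h'. lra.
Qed.

Lemma c0_bounded (G : Type) (f : G -> R) : c0 f -> exists b, forall g, Rabs (f g) <= b.
Proof.
  intros h. destruct (h 1 Rlt_0_1) as [l hl].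
  (* Requiring [1 <= b] makes the same [b] work off the list, where the values are below 1. *)
  assert (hb : exists b, 1 <= b /\ forall g, In g l -> Rabs (f g) <= b).
  { clear hl. induction l as [|a l [b [h1 hb]]].
    - exists 1. split; [lra|intros g []].
    - exists (Rmax b (Rabs (f a))).
      pose proof (Rmax_l b (Rabs (f a))). pose proof (Rmax_r b (Rabs (f a))).
      split; [lra|]. intros g [<-|hg]; [lra|]. specialize (hb g hg). lra. }
  destruct hb as [b [h1 hb]]. exists b. intros g.
  destruct (Rle_or_lt 1 (Rabs (f g))) as [h2|h2]; [auto|lra].
Qed.

Lemma Rabs_le_supnorm (G : Type) (f : G -> R) g : c0 f -> Rabs (f g) <= supnorm f.
Proof.
  intros h. destruct (c0_bounded G f h) as [b hb].
  apply Rsup_ub with b; [intros y [g' ->]; auto|exists g; reflexivity].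
Qed.

Lemma supnorm_le (G : Type) (f : G -> R) b :
  0 <= b -> (forall g, Rabs (f g) <= b) -> supnorm f <= b.
Proof. intros h0 h. apply Rsup_le_nonneg; [exact h0|]. intros y [g ->]; auto. Qed.

(** * Norm estimates in the dual and the bidual *)

Section Dual.

Variables (G : Type) (X : (G -> R) -> Prop).
Hypothesis hX : closed_subspace_c0 X.

Let X_c0 : forall f, X f -> c0 f := proj1 hX.
Let X_0 : X (fun _ => 0) := proj1 (proj2 hX).
Let X_add : forall f h, X f -> X h -> X (fadd f h) := proj1 (proj2 (proj2 hX)).
Let X_scal : forall a f, X f -> X (fscal a f) := proj1 (proj2 (proj2 (proj2 hX))).

Lemma dual_zero phi : in_dual X phi -> phi (fun _ => 0) = 0.
Proof.
  intros [_ [hs _]]. specialize (hs 0 _ X_0).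
  replace (fscal 0 (fun _ : G => 0)) with (fun _ : G => 0) in hs; [lra|].
  extensionality g. unfold fscal. ring.
Qed.

Lemma dnorm_nonneg (phi : (G -> R) -> R) : 0 <= dnorm X phi.
Proof. apply Rsup_nonneg. intros y [f [_ [_ ->]]]. apply Rabs_pos. Qed.

Lemma Rabs_le_dnorm phi f : in_dual X phi -> X f -> (forall g, Rabs (f g) <= 1) ->
  Rabs (phi f) <= dnorm X phi.
Proof.
  intros [_ [_ [M hM]]] hf h1.
  (* If [X] is zero, [M] may be negative; then only [Rabs M] bounds the set. *)
  apply Rsup_ub with (Rabs M).
  - intros y [h [hh [hh1 ->]]]. specialize (hM h hh).
    assert (0 <= supnorm h).
    { apply Rsup_nonneg. intros z [g ->]. apply Rabs_pos. }
    pose proof (Rle_abs M). pose proof (Rabs_pos M). nra.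
  - exists f. repeat split; auto. apply supnorm_le; [lra|exact h1].
Qed.

Lemma Rabs_le_dnorm_mul phi f b : in_dual X phi -> X f -> 0 < b ->
  (forall g, Rabs (f g) <= b) -> Rabs (phi f) <= b * dnorm X phi.
Proof.
  intros hp hf hb h.
  assert (h1 : Rabs (phi (fscal (/ b) f)) <= dnorm X phi).
  { apply Rabs_le_dnorm; auto. intros g. unfold fscal.
    rewrite Rabs_mult, Rabs_inv, (Rabs_pos_eq b) by lra.
    apply Rmult_le_reg_l with b; [exact hb|].
    rewrite <- Rmult_assoc, Rinv_r by lra. specialize (h g). lra. }
  destruct hp as [_ [hs _]]. rewrite hs in h1 by exact hf.
  rewrite Rabs_mult, Rabs_inv, (Rabs_pos_eq b) in h1 by lra.
  apply Rmult_le_compat_l with (r := b) in h1; [|lra].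
  rewrite <- Rmult_assoc, Rinv_r, Rmult_1_l in h1 by lra. exact h1.
Qed.

Lemma dnorm_gt phi t : in_dual X phi -> t < dnorm X phi ->
  exists f, X f /\ (forall g, Rabs (f g) <= 1) /\ t < phi f.
Proof.
  intros hp ht. apply Rsup_gt in ht.
  - destruct ht as [r [[f [hf [hf1 ->]]] ht]].
    assert (h1 : forall g, Rabs (f g) <= 1).
    { intros g. pose proof (Rabs_le_supnorm G f g (X_c0 f hf)). lra. }
    destruct (Rle_or_lt 0 (phi f)) as [h0|h0].
    + exists f. rewrite Rabs_pos_eq in ht by exact h0. auto.
    + exists (fscal (-1) f). destruct hp as [_ [hs _]]. rewrite hs by exact hf.
      rewrite Rabs_left in ht by exact h0. split; [auto|]. split; [|lra].
      intros g. unfold fscal. replace (-1 * f g) with (- f g) by ring. rewrite Rabs_Ropp. auto.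
  - exists 0, (fun _ => 0). split; [exact X_0|]. split.
    + apply supnorm_le; [lra|]. intros g. rewrite Rabs_R0. lra.
    + rewrite dual_zero, Rabs_R0; auto.
Qed.

Lemma in_dual_add phi psi : in_dual X phi -> in_dual X psi -> in_dual X (dadd phi psi).
Proof.
  intros [a1 [s1 [M1 b1]]] [a2 [s2 [M2 b2]]]. unfold dadd. split; [|split].
  - intros f h hf hh. rewrite a1, a2 by auto. ring.
  - intros a f hf. rewrite s1, s2 by auto. ring.
  - exists (M1 + M2). intros f hf. specialize (b1 f hf). specialize (b2 f hf).
    pose proof (Rabs_triang (phi f) (psi f)). lra.
Qed.

Lemma in_dual_scal a phi : in_dual X phi -> in_dual X (dscal a phi).
Proof.
  intros [a1 [s1 [M1 b1]]]. unfold dscal. split; [|split].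
  - intros f h hf hh. rewrite a1 by auto. ring.
  - intros b f hf. rewrite s1 by auto. ring.
  - exists (Rabs a * M1). intros f hf. specialize (b1 f hf).
    rewrite Rabs_mult. pose proof (Rabs_pos a). nra.
Qed.

(** Linearity in [in_bidual] is stated for [dadd] and [dscal]; differences are reduced to these. *)
Lemma dsubE (phi psi : (G -> R) -> R) : dsub phi psi = dadd phi (dscal (-1) psi).
Proof. extensionality f. unfold dsub, dadd, dscal. ring. Qed.

Lemma in_dual_sub phi psi : in_dual X phi -> in_dual X psi -> in_dual X (dsub phi psi).
Proof. intros h1 h2. rewrite dsubE. auto using in_dual_add, in_dual_scal. Qed.

(** Normalising by [dnorm X phi + 1] avoids dividing by a zero norm. The crude bound suffices: it
    only serves to show that the sets behind [delta] are bounded. *)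
Lemma Rabs_le_bidnorm Phi phi : in_bidual X Phi -> bidnorm X Phi <= 1 -> in_dual X phi ->
  Rabs (Phi phi) <= dnorm X phi + 1.
Proof.
  intros [_ [hs [M hM]]] h1 hp.
  pose proof (dnorm_nonneg phi) as h0.
  set (b := dnorm X phi + 1). assert (hb : 0 < b) by (unfold b; lra).
  assert (h2 : Rabs (Phi (dscal (/ b) phi)) <= 1).
  { apply Rle_trans with (2 := h1). apply Rsup_ub with (Rabs M).
    - intros y [psi [hpsi [hn ->]]]. specialize (hM psi hpsi).
      pose proof (dnorm_nonneg psi). pose proof (Rle_abs M). pose proof (Rabs_pos M). nra.
    - exists (dscal (/ b) phi). split; [auto using in_dual_scal|]. split; [|reflexivity].
      apply Rsup_le_nonneg; [lra|]. intros y [f [hf [hf1 ->]]]. unfold dscal.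
      rewrite Rabs_mult, Rabs_inv, (Rabs_pos_eq b) by lra.
      apply Rmult_le_reg_l with b; [exact hb|].
      rewrite <- Rmult_assoc, Rinv_r, Rmult_1_l by lra.
      apply Rle_trans with (dnorm X phi); [|unfold b; lra].
      apply Rabs_le_dnorm; auto. intros g.
      pose proof (Rabs_le_supnorm G f g (X_c0 f hf)). lra. }
  rewrite hs in h2 by exact hp.
  rewrite Rabs_mult, Rabs_inv, (Rabs_pos_eq b) in h2 by lra.
  apply Rmult_le_compat_l with (r := b) in h2; [|lra].
  rewrite <- Rmult_assoc, Rinv_r in h2 by lra. lra.
Qed.

End Dual.

(** * Limits along a free ultrafilter *)

(** Properness takes the form [fu_ex], so that an index meeting finitely many large conditions can
    be picked at once; [fu_tail] is freeness. *)
Record free_ultrafilter (U : (nat -> Prop) -> Prop) : Prop := {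
  fu_and : forall P Q, U P -> U Q -> U (fun n => P n /\ Q n);
  fu_mono : forall P Q : nat -> Prop, (forall n, P n -> Q n) -> U P -> U Q;
  fu_ex : forall P, U P -> exists n, P n;
  fu_em : forall P, U P \/ U (fun n => ~ P n);
  fu_tail : forall p, U (fun n => (p <= n)%nat) }.

Lemma free_ultrafilter_exists : exists U, free_ultrafilter U.
Proof.
  (* Any ultrafilter above the filter of cofinite sets contains all tails. *)
  set (F := fun P : nat -> Prop => exists p, forall n, (p <= n)%nat -> P n).
  assert (hF : filter.ProperFilter F).
  { constructor.
    - intros [p hp]. exact (hp p (le_n p)).
    - constructor.
      + exists 0%nat. intros; exact I.
      + intros A B [p hp] [q hq]. exists (p + q)%nat.
        intros n hn. split; [apply hp|apply hq]; lia.
      + intros P Q hPQ [p hp]. exists p. intros n hn. apply hPQ, hp, hn. }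
  destruct (filter.ultraFilterLemma hF) as [U [hU hFU]].
  pose proof (@filter.ultra_proper _ _ hU) as hP.
  pose proof (@filter.filter_filter _ _ hP) as hf.
  exists U. constructor.
  - intros P Q. apply (@filter.filterI _ _ hf).
  - intros P Q. apply (@filter.filterS _ _ hf).
  - intros P h. apply NNPP. intros hn. apply (@filter.filter_not_empty _ _ hP).
    apply (@filter.filterS _ _ hf P); [|exact h]. intros n hPn. elim hn. exists n. exact hPn.
  - intros P. exact (filter.in_ultra_setVsetC P hU).
  - intros p. apply hFU. exists p. auto.
Qed.

Definition Ulim (U : (nat -> Prop) -> Prop) (a : nat -> R) (l : R) : Prop :=
  forall eps, 0 < eps -> U (fun n => Rabs (a n - l) < eps).

Section Ultralimits.

Variable U : (nat -> Prop) -> Prop.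
Hypothesis hU : free_ultrafilter U.

Lemma fu_all P : (forall n, P n) -> U P.
Proof. intros h. apply (fu_mono U hU) with (2 := fu_tail U hU 0). auto. Qed.

Lemma fu_list (T : Type) (l : list T) (P : T -> nat -> Prop) :
  (forall x, U (P x)) -> U (fun n => forall x, In x l -> P x n).
Proof.
  intros h. induction l as [|a l IH].
  - apply fu_all. intros n x [].
  - apply (fu_mono U hU) with (2 := fu_and U hU _ _ (h a) IH).
    intros n [h1 h2] x [<-|hx]; auto.
Qed.

(** The limit is the supremum of the levels [t] with [t <= a n] for most [n]; above it, the
    ultrafilter dichotomy puts the complementary set in [U]. *)
Lemma Ulim_bounded a K : (forall n, Rabs (a n) <= K) -> exists l, Ulim U a l.
Proof.
  intros hK.
  assert (hK' : forall n, - K <= a n <= K).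
  { intros n. apply Rabs_le_inv. auto. }
  set (E := fun t => U (fun n => t <= a n)).
  destruct (completeness E) as [l [hub hl]].
  - exists K. intros t ht. destruct (fu_ex U hU _ ht) as [n hn]. specialize (hK' n). lra.
  - exists (- K). apply fu_all. intros n. apply hK'.
  - exists l. intros eps he.
    assert (h1 : U (fun n => a n < l + eps)).
    { destruct (fu_em U hU (fun n => l + eps <= a n)) as [h|h].
      - specialize (hub _ h). lra.
      - apply (fu_mono U hU) with (2 := h). intros n. lra. }
    assert (h2 : exists t, E t /\ l - eps < t).
    { apply NNPP. intros hn. enough (l <= l - eps) by lra. apply hl. intros t ht.
      destruct (Rle_or_lt t (l - eps)); [assumption|]. elim hn; eauto. }
    destruct h2 as [t [ht hlt]].
    apply (fu_mono U hU) with (2 := fu_and U hU _ _ h1 ht).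
    intros n [h3 h4]. apply Rabs_def1; lra.
Qed.

Lemma Ulim_le a l b : Ulim U a l -> U (fun n => a n <= b) -> l <= b.
Proof.
  intros hl hb. apply Rnot_lt_le. intros hlt.
  destruct (fu_ex U hU _ (fu_and U hU _ _ hb (hl (l - b) ltac:(lra)))) as [n [h1 h2]].
  apply Rabs_def2 in h2. lra.
Qed.

Lemma Ulim_plus a b l m : Ulim U a l -> Ulim U b m -> Ulim U (fun n => a n + b n) (l + m).
Proof.
  intros ha hb eps he.
  apply (fu_mono U hU)
    with (2 := fu_and U hU _ _ (ha (eps / 2) ltac:(lra)) (hb (eps / 2) ltac:(lra))).
  intros n [h1 h2]. apply Rabs_def2 in h1, h2. apply Rabs_def1; lra.
Qed.

Lemma Ulim_scal c a l : Ulim U a l -> Ulim U (fun n => c * a n) (c * l).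
Proof.
  intros ha eps he.
  pose proof (Rabs_pos c).
  assert (h0 : 0 < eps / (Rabs c + 1)) by (apply Rdiv_lt_0_compat; lra).
  apply (fu_mono U hU) with (2 := ha _ h0). intros n hn.
  replace (c * a n - c * l) with (c * (a n - l)) by ring. rewrite Rabs_mult.
  apply Rmult_lt_compat_r with (r := Rabs c + 1) in hn; [|lra].
  unfold Rdiv in hn. rewrite Rmult_assoc, Rinv_l, Rmult_1_r in hn by lra.
  pose proof (Rabs_pos (a n - l)). nra.
Qed.

Lemma Ulim_ge a l b : Ulim U a l -> U (fun n => b <= a n) -> b <= l.
Proof.
  intros hl hb. enough (-1 * l <= - b) by lra.
  apply (Ulim_le _ _ _ (Ulim_scal (-1) _ _ hl)).
  apply (fu_mono U hU) with (2 := hb). intros n. lra.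
Qed.

Lemma Ulim_Rabs_le a l K : Ulim U a l -> (forall n, Rabs (a n) <= K) -> Rabs l <= K.
Proof.
  intros hl hK. apply Rabs_le. split.
  - apply (Ulim_ge _ _ _ hl), fu_all. intros n. exact (proj1 (Rabs_le_inv _ _ (hK n))).
  - apply (Ulim_le _ _ _ hl), fu_all. intros n. exact (proj2 (Rabs_le_inv _ _ (hK n))).
Qed.

Lemma Ulim_unique a l m : Ulim U a l -> Ulim U a m -> l = m.
Proof.
  intros hl hm. apply NNPP. intros hne.
  assert (h0 : 0 < Rabs (l - m) / 2).
  { assert (0 < Rabs (l - m)) by (apply Rabs_pos_lt; lra). lra. }
  destruct (fu_ex U hU _ (fu_and U hU _ _ (hl _ h0) (hm _ h0))) as [n [h1 h2]].
  pose proof (Rabs_triang (a n - m) (- (a n - l))) as h3.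
  rewrite Rabs_Ropp in h3.
  replace (a n - m + - (a n - l)) with (l - m) in h3 by ring. lra.
Qed.

End Ultralimits.

(** * The gliding hump *)

Section Gliding.

Variables (G : Type) (X : (G -> R) -> Prop).
Hypothesis hX : closed_subspace_c0 X.
Variable U : (nat -> Prop) -> Prop.
Hypothesis hU : free_ultrafilter U.
Variables (y : nat -> (G -> R) -> R) (f : nat -> G -> R) (t : R).
Hypothesis hy : forall n, in_dual X (y n).
Hypothesis hf : forall n, X (f n).
Hypothesis hf1 : forall n g, Rabs (f n g) <= 1.
Hypothesis hyf : forall n, t < y n (f n).

Let X_c0 : forall f, X f -> c0 f := proj1 hX.
Let X_0 : X (fun _ => 0) := proj1 (proj2 hX).
Let X_add : forall f h, X f -> X h -> X (fadd f h) := proj1 (proj2 (proj2 hX)).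
Let X_scal : forall a f, X f -> X (fscal a f) := proj1 (proj2 (proj2 (proj2 hX))).

Let y_add n u v : X u -> X v -> y n (fadd u v) = y n u + y n v.
Proof. destruct (hy n) as [h _]. auto. Qed.
Let y_scal n c u : X u -> y n (fscal c u) = c * y n u.
Proof. destruct (hy n) as [_ [h _]]. auto. Qed.

Variables (f' : G -> R) (b a : nat -> R) (alpha : R).
Hypothesis hf' : forall g, Ulim U (fun n => f n g) (f' g).
Hypothesis hb : forall j, Ulim U (fun n => y j (f n)) (b j).
Hypothesis ha : forall m, Ulim U (fun n => y n (f m)) (a m).
Hypothesis halpha : Ulim U a alpha.

(* The summands [f m] of [u] are chosen one after the other, each almost equal to
   the limit [f'] on the essential supports of the previous ones.  Then, at a
   given point, the first differences [f n - f m] are about [f n], one of them is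
   at most [2], and the remaining ones are small; hence [N + 1] instead of the
   trivial bound [2 * N]. *)
Lemma sum_approximation N (F : list G) (L : list nat) eta : 0 < eta ->
  exists u, X u /\
    U (fun n => Rabs (y n u - INR N * alpha) <= eta) /\
    U (fun n => (forall g, Rabs (INR N * f n g - u g) <= INR N + 1 + eta) /\
                (forall g, In g F -> Rabs (INR N * f n g - u g) <= eta) /\
                (forall j, In j L -> Rabs (INR N * y j (f n) - y j u) <= eta)).
Proof.
  revert F eta. induction N as [|N IH]; intros F eta heta.
  - exists (fun _ => 0). split; [exact X_0|].
    assert (hz : forall r, Rabs (INR 0 * r - 0) = 0).
    { intros r. simpl. replace (0 * r - 0) with 0 by ring. apply Rabs_R0. }
    split; apply (fu_all U hU); intros n.
    + rewrite (dual_zero G X hX) by auto. rewrite Rabs_minus_sym, hz. lra.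
    + split; [|split]; intros; rewrite ?(dual_zero G X hX), hz by auto; simpl; lra.
  (* Two errors [d] come from replacing [f n] and [f m] by their common limit, or [y n (f m)] by
     [a m] and then [alpha]; the other [eta / 2] is left to the induction hypothesis. *)
  - set (d := eta / 4). assert (hd : 0 < d) by (unfold d; lra).
    pose proof (fu_and U hU _ _
      (fu_list U hU _ F (fun g n => Rabs (f n g - f' g) < d) (fun g => hf' g d hd))
      (fu_list U hU _ L (fun j n => Rabs (y j (f n) - b j) < d) (fun j => hb j d hd))) as hnear.
    destruct (fu_ex U hU _ (fu_and U hU _ _ hnear (halpha d hd))) as [m [[hmF hmL] hma]].
    destruct (X_c0 (f m) (hf m) d hd) as [l hl].
    (* Adding the essential support [l] of [f m] to [F] forces the remaining summands to be almost
       [f'] there. *)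
    destruct (IH (F ++ l) (eta / 2)) as [u [hu [hu1 hu2]]]; [lra|].
    exists (fadd (f m) u). split; [auto|]. rewrite S_INR. split.
    + apply (fu_mono U hU) with (2 := fu_and U hU _ _ (ha m d hd) hu1).
      intros n [h1 h2]. rewrite y_add by auto.
      apply Rabs_def2 in h1, hma. apply Rabs_le_inv in h2. apply Rabs_le. unfold d in *. lra.
    + apply (fu_mono U hU) with (2 := fu_and U hU _ _ hnear hu2).
      intros n [[h1 h2] [h3 [h4 h5]]].
      assert (h6 : forall g, In g F -> Rabs ((INR N + 1) * f n g - fadd (f m) u g) <= eta).
      { intros g hg. unfold fadd.
        specialize (h1 g hg). specialize (hmF g hg). specialize (h4 g ltac:(apply in_or_app; auto)).
        apply Rabs_def2 in h1, hmF. apply Rabs_le_inv in h4. apply Rabs_le. unfold d in *. lra. }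
      repeat split; [|exact h6|].
      * intros g. unfold fadd. pose proof (pos_INR N).
        pose proof (Rabs_le_inv _ _ (hf1 n g)). pose proof (Rabs_le_inv _ _ (hf1 m g)).
        (* On [l] the new difference is at most 2 and the others add up to at most [eta / 2]. Off
           [l] the new one is at most [1 + d] and the others give at most [INR N + 1 + eta / 2]. *)
        destruct (classic (In g l)) as [hg|hg].
        -- specialize (h4 g ltac:(apply in_or_app; auto)).
           apply Rabs_le_inv in h4. apply Rabs_le. lra.
        -- assert (hs : Rabs (f m g) < d).
           { apply Rnot_le_lt. intros hs. apply hg, hl, hs. }
           specialize (h3 g). apply Rabs_def2 in hs. apply Rabs_le_inv in h3.
           apply Rabs_le. unfold d in *. lra.
      * intros j hj. rewrite y_add by auto.
        specialize (h2 j hj). specialize (hmL j hj). specialize (h5 j hj).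
        apply Rabs_def2 in h2, hmL. apply Rabs_le_inv in h5. apply Rabs_le. unfold d in *. lra.
Qed.

(** Dividing the sum by [N] turns the bound [N + 1 + eps] into [1 + (1 + eps) / N], which is at most
    [1 + eps] once [N] exceeds [1 + / eps]. *)
Lemma mean_approximation (F : list G) (L : list nat) eps : 0 < eps ->
  exists u, X u /\
    U (fun n => Rabs (y n u - alpha) <= eps) /\
    U (fun n => (forall g, Rabs (f n g - u g) <= 1 + eps) /\
                (forall g, In g F -> Rabs (f n g - u g) <= eps) /\
                (forall j, In j L -> Rabs (y j (f n) - y j u) <= eps)).
Proof.
  intros he. destruct (INR_unbounded (1 + / eps)) as [N hN].
  assert (hi : 0 < / eps) by (apply Rinv_0_lt_compat; exact he).
  assert (hN0 : 0 < INR N) by lra.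
  assert (hNe : 1 < INR N * eps - eps).
  { apply Rmult_lt_compat_r with (r := eps) in hN; [|exact he].
    rewrite Rmult_plus_distr_r, Rinv_l in hN by lra. lra. }
  assert (hdiv : forall p q c, Rabs (INR N * p - q) <= INR N * c -> Rabs (p - / INR N * q) <= c).
  { intros p q c h. apply Rmult_le_reg_l with (INR N); [exact hN0|].
    apply Rle_trans with (2 := h). rewrite <- (Rabs_pos_eq (INR N)) at 1 by lra.
    rewrite <- Rabs_mult. right. f_equal. field. lra. }
  destruct (sum_approximation N F L eps he) as [u [hu [hu1 hu2]]].
  exists (fscal (/ INR N) u). split; [auto|]. split.
  - apply (fu_mono U hU) with (2 := hu1). intros n hn. rewrite y_scal by exact hu.
    rewrite Rabs_minus_sym. apply hdiv. rewrite Rabs_minus_sym. lra.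
  - apply (fu_mono U hU) with (2 := hu2). intros n [h1 [h2 h3]].
    repeat split; intros.
    + apply hdiv. specialize (h1 g). lra.
    + apply hdiv. specialize (h2 g H). lra.
    + rewrite y_scal by exact hu. apply hdiv. specialize (h3 j H). lra.
Qed.

(** All estimates worsen additively by multiples of [eps], so the step can be iterated with summable
    errors. [J] protects the functionals used earlier. *)
Lemma hump_step u c eps (J : nat) : X u -> 0 < eps ->
  U (fun n => Rabs (y n u - alpha) <= c) ->
  exists w n, X w /\ (J <= n)%nat /\
    (forall B, 1 <= B -> (forall g, Rabs (u g) <= B) -> forall g, Rabs (w g) <= B + 2 * eps) /\
    (forall j, (j < J)%nat -> Rabs (y j w - y j u) <= eps) /\
    U (fun n => Rabs (y n w - alpha) <= c + 3 * eps) /\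
    t - c - eps <= y n w.
Proof.
  intros hu he huc.
  destruct (X_c0 u hu eps he) as [F hF].
  destruct (mean_approximation F (seq 0 J) eps he) as [h [hh [hh1 hh2]]].
  (* Besides fitting [u] and [h], the index [n] must have [a n] near [alpha], so that later
     functionals still take values near [alpha] at [w]. *)
  destruct (fu_ex U hU _ (fu_and U hU _ _ (fu_and U hU _ _ (fu_tail U hU J) (halpha eps he))
    (fu_and U hU _ _ (fu_and U hU _ _ huc hh1) hh2)))
    as [n [[hJ hn] [[h1 h2] [h3 [h4 h5]]]]].
  exists (fadd u (fadd (f n) (fscal (-1) h))), n.
  assert (hw : forall j, y j (fadd u (fadd (f n) (fscal (-1) h))) = y j u + (y j (f n) - y j h)).
  { intros j. rewrite !y_add, y_scal by auto. ring. }
  split; [auto 6|]. split; [exact hJ|]. split; [|split; [|split]].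
  - intros B hB1 hB g. unfold fadd, fscal.
    (* On [F] the added term [f n - h] is at most [eps]; off [F] it is at most [1 + eps] while [u]
       is below [eps], and [1 <= B] absorbs this. *)
    destruct (classic (In g F)) as [hg|hg].
    + specialize (hB g). specialize (h4 g hg). apply Rabs_le_inv in hB, h4. apply Rabs_le. lra.
    + assert (hs : Rabs (u g) < eps).
      { apply Rnot_le_lt. intros hs. apply hg, hF, hs. }
      specialize (h3 g). apply Rabs_def2 in hs. apply Rabs_le_inv in h3. apply Rabs_le. lra.
  - intros j hj. rewrite hw. replace (y j u + (y j (f n) - y j h) - y j u)
      with (y j (f n) - y j h) by ring. apply h5, in_seq. lia.
  (* The three errors [eps] come from [y k h] against [alpha], [y k (f n)] against [a n], and [a n]
     against [alpha]. *)
  - apply (fu_mono U hU)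
      with (2 := fu_and U hU _ _ (fu_and U hU _ _ huc hh1) (ha n eps he)).
    intros k [[k1 k2] k3]. rewrite hw. apply Rabs_def2 in k3, hn.
    apply Rabs_le_inv in k1, k2. apply Rabs_le. lra.
  - rewrite hw. specialize (hyf n). apply Rabs_le_inv in h1, h2. lra.
Qed.

End Gliding.

(** The functional [y (n (S k))] is large on [u (S k)], and the later steps change its values by
    summable amounts only. *)
Lemma hump_sequence (G : Type) (X : (G -> R) -> Prop) (U : (nat -> Prop) -> Prop)
  (y : nat -> (G -> R) -> R) (f : nat -> G -> R) (t K eps : R) :
  closed_subspace_c0 X -> free_ultrafilter U -> (forall n, in_dual X (y n)) ->
  (forall n u, X u -> (forall g, Rabs (u g) <= 1) -> Rabs (y n u) <= K) ->
  (forall n, X (f n)) -> (forall n g, Rabs (f n g) <= 1) -> (forall n, t < y n (f n)) ->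
  0 < eps ->
  exists (u : nat -> G -> R) (n : nat -> nat),
    (forall k, X (u k)) /\ (forall k g, Rabs (u k g) <= 1 + eps) /\
    (forall k, (k <= n k)%nat) /\
    (forall k l, (k < l)%nat -> t - eps <= y (n (S k)) (u l)).
Proof.
  intros hX hU hy hK hf hf1 hyf heps.
  destruct (choice (fun g l => Ulim U (fun n => f n g) l)) as [f' hf'].
  { intros g. apply (Ulim_bounded U hU) with 1. auto. }
  destruct (choice (fun j l => Ulim U (fun n => y j (f n)) l)) as [b hb].
  { intros j. apply (Ulim_bounded U hU) with K. auto. }
  destruct (choice (fun m l => Ulim U (fun n => y n (f m)) l)) as [a ha].
  { intros m. apply (Ulim_bounded U hU) with K. auto. }
  destruct (Ulim_bounded U hU a K) as [alpha halpha].
  { intros m. apply (Ulim_Rabs_le U hU _ _ _ (ha m)). auto. }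
  (* Here [E k] is the sum of the errors [e i] for [i < k], and stays below [d]. A step loses at
     most [5 * d] and the later drift is below [d], which together fit into [eps]. *)
  set (d := eps / 8). assert (hd : 0 < d) by (unfold d; lra).
  set (E := fun k => d * (1 - (/ 2) ^ k)).
  set (e := fun k => d * (/ 2) ^ S k).
  assert (hp : forall k, 0 < (/ 2) ^ k) by (intros k; apply pow_lt; lra).
  assert (he : forall k, 0 < e k) by (intros k; apply Rmult_lt_0_compat; auto).
  assert (hES : forall k, E (S k) = E k + e k) by (intros k; unfold E, e; simpl; field).
  assert (hEd : forall k, E k < d) by (intros k; unfold E; pose proof (hp k); nra).
  assert (hE0 : E 0%nat = 0) by (unfold E; simpl; ring).
  assert (hEmono : forall k l, (k <= l)%nat -> E k <= E l).
  { intros k l hkl. induction hkl as [|l _ IH]; [lra|]. rewrite hES. pose proof (he l). lra. }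
  set (Inv := fun k (s : (G -> R) * nat) => X (fst s) /\
    (forall g, Rabs (fst s g) <= 1 + 2 * E k) /\
    U (fun n => Rabs (y n (fst s) - alpha) <= d + 3 * E k)).
  set (Step := fun k (s s' : (G -> R) * nat) => Inv (S k) s' /\ (snd s < snd s')%nat /\
    (forall j, (j <= snd s)%nat -> Rabs (y j (fst s') - y j (fst s)) <= e k) /\
    t - 5 * d <= y (snd s') (fst s')).
  (* With [Inv] as a premise under the existential, a successor exists for every pair, so the
     recursion can be run before the invariant is known. *)
  assert (hstep : forall k s, exists s', Inv k s -> Step k s s').
  { intros k s. destruct (classic (Inv k s)) as [hI|hI]; [|exists s; tauto].
    destruct hI as [h1 [h2 h3]].
    destruct (hump_step G X hX U hU y f t hy hf hf1 hyf f' b a alpha hf' hb ha halpha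
      (fst s) _ (e k) (S (snd s)) h1 (he k) h3) as [w [n [w1 [w2 [w3 [w4 [w5 w6]]]]]]].
    pose proof (hEmono 0%nat k ltac:(lia)).
    exists (w, n). intros _. repeat split; simpl; auto.
    - intros g. rewrite hES. specialize (w3 (1 + 2 * E k) ltac:(lra) h2 g). lra.
    - apply (fu_mono U hU) with (2 := w5). intros k'. rewrite hES. lra.
    - intros j hj. apply w4. lia.
    - pose proof (hEd k). pose proof (hEd (S k)). rewrite hES in *. lra. }
  (* Starting at [f m] with [a m] within [d / 2] of [alpha] gives the error [d] in [Inv 0]. *)
  destruct (fu_ex U hU _ (halpha (d / 2) ltac:(lra))) as [m hm].
  (* The initial index 0 is a dummy with no lower bound attached, hence [n (S k)] in the
     conclusion. *)
  set (s := nat_rect (fun _ => ((G -> R) * nat)%type) (f m, 0%nat)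
    (fun k p => proj1_sig (constructive_indefinite_description _ (hstep k p)))).
  assert (hInv : forall k, Inv k (s k)).
  { induction k as [|k IH].
    - repeat split; simpl; auto.
      + intros g. rewrite hE0. specialize (hf1 m g). lra.
      + apply (fu_mono U hU) with (2 := ha m (d / 2) ltac:(lra)). intros n hn.
        rewrite hE0. apply Rabs_def2 in hm, hn. apply Rabs_le. lra.
    - simpl. destruct (constructive_indefinite_description _ (hstep k (s k))) as [s' hs'].
      apply hs', IH. }
  assert (hS : forall k, Step k (s k) (s (S k))).
  { intros k. simpl. destruct (constructive_indefinite_description _ (hstep k (s k))) as [s' hs'].
    apply hs', hInv. }
  assert (hmono : forall k l, (k <= l)%nat -> (snd (s k) <= snd (s l))%nat).
  { intros k l hkl. induction hkl as [|l _ IH]; [lia|]. destruct (hS l) as [_ [h _]]. lia. }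
  exists (fun k => fst (s k)), (fun k => snd (s k)).
  split; [intros k; apply hInv|]. split; [|split].
  - intros k g. destruct (hInv k) as [_ [h _]]. specialize (h g). pose proof (hEd k).
    unfold d in *. lra.
  - induction k as [|k IH]; [lia|]. destruct (hS k) as [_ [h _]]. lia.
  - intros k l hkl.
    (* Tracking the exact drift [E l - E (S k)] lets the induction on [l] telescope. *)
    enough (t - 5 * d - (E l - E (S k)) <= y (snd (s (S k))) (fst (s l))).
    { pose proof (hEd l). pose proof (hEmono 0%nat (S k) ltac:(lia)). unfold d in *. lra. }
    induction hkl as [|l hkl IH].
    + destruct (hS k) as [_ [_ [_ h]]]. lra.
    + destruct (hS l) as [_ [_ [h _]]]. specialize (h _ (hmono _ _ hkl)).
      rewrite hES. apply Rabs_le_inv in h. lra.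
Qed.

(** * Norming elements of the bidual *)

(** [Phi] is the weak* limit of the [u k] viewed in the bidual; uniqueness of limits makes it linear
    on the dual, and its values elsewhere are arbitrary. *)
Lemma bidual_limit (G : Type) (X : (G -> R) -> Prop) (U : (nat -> Prop) -> Prop)
  (u : nat -> G -> R) B :
  closed_subspace_c0 X -> free_ultrafilter U -> 0 < B -> (forall k, X (u k)) ->
  (forall k g, Rabs (u k g) <= B) ->
  exists Phi, in_bidual X Phi /\
    (forall phi, in_dual X phi -> Rabs (Phi phi) <= B * dnorm X phi) /\
    (forall phi, in_dual X phi -> Ulim U (fun k => phi (u k)) (Phi phi)).
Proof.
  intros hX hU hB hu huB.
  assert (hbd : forall phi k, in_dual X phi -> Rabs (phi (u k)) <= B * dnorm X phi).
  { intros phi k hp. apply Rabs_le_dnorm_mul; auto. }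
  destruct (choice (fun phi l => in_dual X phi -> Ulim U (fun k => phi (u k)) l)) as [Phi hPhi].
  { intros phi. destruct (classic (in_dual X phi)) as [hp|hp]; [|exists 0; tauto].
    destruct (Ulim_bounded U hU (fun k => phi (u k)) (B * dnorm X phi)) as [l hl]; eauto. }
  assert (hle : forall phi, in_dual X phi -> Rabs (Phi phi) <= B * dnorm X phi).
  { intros phi hp. apply (Ulim_Rabs_le U hU _ _ _ (hPhi phi hp)). auto. }
  exists Phi. repeat split; auto; [| |eauto].
  - intros phi psi hp hq. apply (Ulim_unique U hU (fun k => dadd phi psi (u k))).
    + apply hPhi, in_dual_add; auto.
    + apply Ulim_plus; auto.
  - intros c phi hp. apply (Ulim_unique U hU (fun k => dscal c phi (u k))).
    + apply hPhi, in_dual_scal; auto.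
    + apply Ulim_scal; auto.
Qed.

Lemma bidual_norming (G : Type) (X : (G -> R) -> Prop) (y : nat -> (G -> R) -> R) (t s K : R) :
  closed_subspace_c0 X -> (forall n, in_dual X (y n)) -> (forall n, dnorm X (y n) <= K) ->
  (forall n, t < dnorm X (y n)) -> s < t ->
  exists Phi, in_bidual X Phi /\ bidnorm X Phi <= 1 /\
    forall p, exists n, (p <= n)%nat /\ s <= Phi (y n).
Proof.
  intros hX hy hK ht hst.
  destruct free_ultrafilter_exists as [U hU].
  destruct (choice (fun n f => X f /\ (forall g, Rabs (f g) <= 1) /\ t < y n f)) as [f hf].
  { intros n. apply dnorm_gt; auto. }
  (* This makes [(1 + eps) * s <= s + eps * Rabs s = t - eps], so the lower bound is still [s] after
     division by [1 + eps]. *)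
  set (eps := (t - s) / (1 + Rabs s)).
  pose proof (Rabs_pos s) as hs0.
  assert (he : 0 < eps) by (apply Rdiv_lt_0_compat; lra).
  assert (hes : eps * (1 + Rabs s) = t - s) by (unfold eps; field; lra).
  destruct (hump_sequence G X U y f t K eps) as [u [n [hu [hu1 [hn hyu]]]]]; auto;
    try (intros k; apply hf).
  { intros k v hv hv1. apply Rle_trans with (2 := hK k). apply Rabs_le_dnorm; auto. }
  destruct (bidual_limit G X U u (1 + eps) hX hU) as [Psi [hPsi [hPsi1 hPsi2]]]; auto; [lra|].
  assert (hPhi1 : forall phi, in_dual X phi -> Rabs (/ (1 + eps) * Psi phi) <= dnorm X phi).
  { intros phi hp. rewrite Rabs_mult, Rabs_inv, (Rabs_pos_eq (1 + eps)) by lra.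
    apply Rmult_le_reg_l with (1 + eps); [lra|].
    rewrite <- Rmult_assoc, Rinv_r, Rmult_1_l by lra. auto. }
  exists (fun phi => / (1 + eps) * Psi phi). split; [|split].
  - destruct hPsi as [h1 [h2 _]]. split; [|split].
    + intros phi psi hp hq. rewrite h1 by auto. ring.
    + intros c phi hp. rewrite h2 by auto. ring.
    + exists 1. intros phi hp. rewrite Rmult_1_l. auto.
  - apply Rsup_le_nonneg; [lra|]. intros r [phi [hp [hp1 ->]]].
    apply Rle_trans with (2 := hp1). auto.
  (* All [u l] with [l > S p] satisfy the lower bound at this functional, hence so does their
     limit. *)
  - intros p. exists (n (S p)). split; [specialize (hn (S p)); lia|].
    assert (h : t - eps <= Psi (y (n (S p)))).
    { apply (Ulim_ge U hU _ _ _ (hPsi2 _ (hy _))).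
      apply (fu_mono U hU) with (2 := fu_tail U hU (S p)). intros l hl. apply hyu. lia. }
    apply Rmult_le_reg_l with (1 + eps); [lra|].
    rewrite <- Rmult_assoc, Rinv_r, Rmult_1_l by lra.
    pose proof (Rle_abs s). nra.
Qed.

(** * Comparison of [ca] and [delta] *)

Theorem theorem1p1 (G : Type) (X : (G -> R) -> Prop)
  (hX : closed_subspace_c0 X)
  (x : nat -> (G -> R) -> R)
  (hx : forall k, in_dual X (x k))
  (hbd : exists M, forall k, dnorm X (x k) <= M) :
  ca X x <= delta X x.
Proof.
  destruct hbd as [M hM].
  apply Rnot_lt_le. intros hlt.
  (* Under [hlt] these thirds satisfy [delta X x < s < t < ca X x]; the contradiction will be
     [s <= delta X x]. *)
  set (s := (2 * delta X x + ca X x) / 3). set (t := (delta X x + 2 * ca X x) / 3).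
  assert (hpair : forall n, exists kl : nat * nat, (n <= fst kl)%nat /\ (n <= snd kl)%nat /\
    t < dnorm X (dsub (x (fst kl)) (x (snd kl)))).
  { intros n.
    destruct (Rsup_gt (fun r => exists k l : nat, (n <= k)%nat /\ (n <= l)%nat /\
      r = dnorm X (dsub (x k) (x l))) t) as [r [[k [l [hk [hl ->]]]] hr]].
    - exists (dnorm X (dsub (x n) (x n))), n, n. auto.
    - apply Rlt_le_trans with (ca X x); [unfold t; lra|].
      apply Rinf_le with 0; [|exists n; reflexivity].
      intros d [m ->]. apply Rsup_nonneg. intros r [k [l [_ [_ ->]]]]. apply dnorm_nonneg.
    - exists (k, l). auto. }
  apply choice in hpair. destruct hpair as [kl hkl].
  set (y := fun n => dsub (x (fst (kl n))) (x (snd (kl n)))).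
  destruct (bidual_norming G X y t s (2 * M)) as [Phi [hPhi [hPhi1 hPhi2]]]; auto.
  - intros n. apply in_dual_sub; auto.
  - intros n. apply Rsup_le_nonneg.
    + pose proof (dnorm_nonneg G X (x 0%nat)). specialize (hM 0%nat). lra.
    + intros r [f [hf [hf1 ->]]]. unfold y, dsub.
      assert (h : forall k, Rabs (x k f) <= M).
      { intros k. apply Rle_trans with (2 := hM k). apply Rabs_le_dnorm; auto.
        intros g. pose proof (Rabs_le_supnorm G f g (proj1 hX f hf)). lra. }
      pose proof (Rabs_le_inv _ _ (h (fst (kl n)))).
      pose proof (Rabs_le_inv _ _ (h (snd (kl n)))). apply Rabs_le. lra.
  - intros n. apply hkl.
  - unfold s, t. lra.
  (* [Rsup] is 0 on unbounded sets, so comparing suprema requires a bound on the oscillations that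
     is uniform in [Psi] and [n]. *)
  - assert (hdiam : forall Psi n, in_bidual X Psi -> bidnorm X Psi <= 1 ->
      forall r, (exists k l : nat, (n <= k)%nat /\ (n <= l)%nat /\
        r = Rabs (Psi (x k) - Psi (x l))) -> r <= 2 * (M + 1)).
    { intros Psi n h1 h2 r [k [l [_ [_ ->]]]].
      assert (h : forall k, Rabs (Psi (x k)) <= M + 1).
      { intros j. pose proof (Rabs_le_bidnorm G X hX Psi (x j) h1 h2 (hx j)).
        specialize (hM j). lra. }
      pose proof (Rabs_le_inv _ _ (h k)). pose proof (Rabs_le_inv _ _ (h l)).
      apply Rabs_le. lra. }
    assert (hs : s <= delta X x); [|unfold s in hs; lra].
    apply Rle_trans with (Rinf (fun d => exists n : nat,
      d = Rsup (fun r => exists k l : nat, (n <= k)%nat /\ (n <= l)%nat /\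
                            r = Rabs (Phi (x k) - Phi (x l))))).
    (* Each tail contains a pair whose difference [y n] has [Phi (y n)] at least [s], so every tail
       diameter is at least [s]. *)
    + apply Rinf_ge; [eexists; exists 0%nat; reflexivity|].
      intros d [p ->]. destruct (hPhi2 p) as [n [hn hsn]]. apply Rle_trans with (1 := hsn).
      destruct (hkl n) as [h1 [h2 _]]. unfold y.
      apply Rle_trans with (Rabs (Phi (x (fst (kl n))) - Phi (x (snd (kl n))))).
      * rewrite dsubE. destruct hPhi as [ha [hs _]].
        rewrite ha, hs by (auto using in_dual_scal).
        eapply Rle_trans; [|apply Rle_abs]. lra.
      * apply Rsup_ub with (2 * (M + 1)); [apply hdiam; auto|].
        exists (fst (kl n)), (snd (kl n)). repeat split; lia.
    + apply Rsup_ub with (2 * (M + 1)); [|exists Phi; auto].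
      intros r [Psi [h1 [h2 ->]]].
      apply Rle_trans with (Rsup (fun r => exists k l : nat, (0 <= k)%nat /\ (0 <= l)%nat /\
                            r = Rabs (Psi (x k) - Psi (x l)))).
      * apply Rinf_le with 0; [|exists 0%nat; reflexivity].
        intros d [n ->]. apply Rsup_nonneg. intros r [k [l [_ [_ ->]]]]. apply Rabs_pos.
      * apply Rsup_le; [|apply hdiam; auto].
        eexists; exists 0%nat, 0%nat. repeat split; lia.
Qed.
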